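(* For $\mathbb{F}\in\{\mathbb{R},\mathbb{C}\}$ and positive integers $d,k$, \[\operatorname{off}_\mathbb{F}(d,k)\geq \frac{1}{\mathcal{L}_\mathbb{F}(d,k)(d+k)-1}.\]
   Context: For a matrix $A\in\mathbb{F}^{n\times n}$, $\operatorname{off}(A):=\max_{i\neq j}|A_{ij}|$, and $\operatorname{off}_\mathbb{F}(d,k):=\min_A\operatorname{off}(A)$ over all $A\in\mathbb{F}^{(d+k)\times(d+k)}$ with $\operatorname{rank}(A)=d$ and $A_{ii}=1$ for all $i$. For a nonzero (Borel) probability mass $\mu$ on $\mathbb{F}^k$ with support $\operatorname{supp}(\mu)$ (the set of points all of whose neighborhoods have positive mass), define \[L_\mathbb{F}(\mu):=\inf_{y\in\operatorname{supp}(\mu)\setminus\{0\}}\ \inf_{v\in\mathbb{F}^k\setminus\{0\}}\frac{\mathbb{E}_{x\sim\mu}|\langle v,x\rangle|}{|\langle v,y\rangle|}.\] Let $\mathcal{P}_\mathbb{F}(d,k)$ be the set of probability masses $\mu$ on $\mathbb{F}^k$ that are the uniform distribution on some multiset of $d+k$ vectors of $\mathbb{F}^k$ spanning $\mathbb{F}^k$ (equivalently: $\operatorname{supp}(\mu)$ is finite, spans $\mathbb{F}^k$, and $(d+k)\mu(x)\in\mathbb{Z}$ for all $x$). Define $\mathcal{L}_\mathbb{F}(d,k):=\sup_{\mu\in\mathcal{P}_\mathbb{F}(d,k)}L_\mathbb{F}(\mu)$. *)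

(* Defs.v *)
From mathcomp Require Export all_boot all_order all_algebra.
From mathcomp Require Export complex.
From mathcomp Require Export all_classical all_reals all_analysis.
Set Implicit Arguments.
Unset Strict Implicit.
Unset Printing Implicit Defensive.
Export Order.TTheory GRing.Theory Num.Theory.
Export numFieldNormedType.Exports.
#[global] Open Scope classical_set_scope.
#[global] Open Scope ring_scope.

Inductive scalar_kind := RealScalars | ComplexScalars.

Definition scalar (R : realType) (K : scalar_kind) : numFieldType :=
  match K with
  | RealScalars => R
  | ComplexScalars => R[i]
  end.

(* The norm of the numFieldType [R[i]] takes its values in [R[i]]; the modulus
   is needed here as an element of [R]. *)
Definition modulus (R : realType) (K : scalar_kind) : scalar R K -> R :=
  match K return scalar R K -> R with
  | RealScalars => fun x : R => `|x|
  | ComplexScalars => fun z : R[i] => complex.Re `|z|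
  end.

Definition conjugate (R : realType) (K : scalar_kind) :
    scalar R K -> scalar R K :=
  match K return scalar R K -> scalar R K with
  | RealScalars => fun x : R => x
  | ComplexScalars => fun z : R[i] => z^*
  end.

Definition inner (R : realType) (K : scalar_kind) (k : nat)
    (v x : 'rV[scalar R K]_k) : scalar R K :=
  \sum_(i < k) conjugate (v 0 i) * x 0 i.

Definition off (R : realType) (K : scalar_kind) (n : nat)
    (A : 'M[scalar R K]_n) : R :=
  \big[Num.max/0]_(p : 'I_n * 'I_n | p.1 != p.2) modulus (A p.1 p.2).

(* For 0 < d this infimum is a minimum: the matrices of rank at most d with unit
   diagonal and bounded entries form a compact set, and a minimizer of smaller
   rank can be turned into one of rank d by changing its off-diagonal entries
   one at a time into those of a full-rank matrix with no larger off. *)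
Definition offmin (R : realType) (K : scalar_kind) (d k : nat) : \bar R :=
  ereal_inf [set (off A)%:E | A in
    [set A : 'M[scalar R K]_(d + k) | \rank A = d /\ forall i, A i i = 1]].

Definition borel_space (R : realType) (K : scalar_kind) (k : nat) :=
  g_sigma_algebraType (@open 'rV[scalar R K]_k).

Definition supp (R : realType) (K : scalar_kind) (k : nat)
    (mu : probability (borel_space R K k) R) : set 'rV[scalar R K]_k :=
  [set y | forall U : set 'rV[scalar R K]_k, open U -> U y -> (0 < mu U)%E].

(* In [\bar R], c / 0 = +oo for c > 0, so that the vectors v orthogonal to y
   do not contribute to the infimum when supp mu spans the whole space. *)
Definition Lmu (R : realType) (K : scalar_kind) (k : nat)
    (mu : probability (borel_space R K k) R) : \bar R :=
  ereal_inf [set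
    ereal_inf [set
      ('E_mu [fun x : borel_space R K k => modulus (inner v x)]
        / (modulus (inner v y))%:E)%E
      | v in [set v : 'rV[scalar R K]_k | v != 0]]
    | y in supp mu `\ 0].

(* A multiset of d + k vectors is encoded by a (d + k)-tuple X; its uniform
   distribution is the average of the Dirac masses at the entries of X. *)
Definition uniform_masses (R : realType) (K : scalar_kind) (d k : nat) :
    set (probability (borel_space R K k) R) :=
  [set mu | exists2 X : (d + k).-tuple 'rV[scalar R K]_k,
      <<X>>%VS = fullv
    & forall B : set (borel_space R K k), measurable B ->
        mu B = (((d + k)%:R^-1)%:E * \sum_(x <- X) \d_(x : borel_space R K k) B)%E].

Definition Lsup (R : realType) (K : scalar_kind) (d k : nat) : \bar R :=
  ereal_sup [set Lmu mu | mu in @uniform_masses R K d k].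

(* Main.v *)
(** Let [A] have rank [d] and unit diagonal, and let the columns of [B] be a
    basis of its kernel; the [d + k] rows [x_i] of [B] span the space.  For
    every [v], the vector of the [<v, x_i>] lies in [ker A], so row [i] of [A]
    gives [|<v, x_i>| <= off A * sum_(j != i) |<v, x_j>|].  Adding
    [off A * |<v, x_i>|] to both sides bounds [L] of the uniform distribution
    on the [x_i] from below by [(1 + off A) / ((d + k) off A)], and solving for
    [off A] gives the claim. *)
Require Import Defs.
From HB Require Import structures.
From mathcomp Require Import lra measurable_realfun.

Set Implicit Arguments.
Unset Strict Implicit.
Unset Printing Implicit Defensive.

(** The norm on [scalar R K] takes its values in [scalar R K] itself. This order embedding of [R]
    lets norm facts be carried over to the real-valued [modulus]. *)
Definition scalar_of_real (R : realType) (K : scalar_kind) : R -> scalar R K :=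
  match K return R -> scalar R K with
  | RealScalars => id
  | ComplexScalars => fun x => x%:C%C
  end.

Arguments scalar_of_real {R} K.

Section Modulus.
Variables (R : realType) (K : scalar_kind).
Implicit Types z w : scalar R K.

Lemma modulusE z : scalar_of_real K (modulus z) = `|z|.
Proof. by case: K z. Qed.

Lemma scalar_of_real0 : scalar_of_real K (0 : R) = 0.
Proof. by case: K. Qed.

Lemma scalar_of_realD (a b : R) :
  scalar_of_real K (a + b) = scalar_of_real K a + scalar_of_real K b.
Proof. by case: K => //=; rewrite rmorphD. Qed.

Lemma scalar_of_realM (a b : R) :
  scalar_of_real K (a * b) = scalar_of_real K a * scalar_of_real K b.
Proof. by case: K => //=; rewrite rmorphM. Qed.

Lemma ler_scalar_of_real :
  {mono (scalar_of_real K : R -> scalar R K) : a b / a <= b}.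
Proof. by case: K => a b //=; rewrite lecR. Qed.

Lemma scalar_of_real_inj : injective (scalar_of_real K : R -> scalar R K).
Proof. exact: inc_inj ler_scalar_of_real. Qed.

Lemma lt_modulus (a : R) z : (a < modulus z) = (scalar_of_real K a < `|z|).
Proof. by rewrite -modulusE (leW_mono ler_scalar_of_real). Qed.

Lemma modulus_ge0 z : 0 <= modulus z.
Proof. by rewrite -ler_scalar_of_real modulusE scalar_of_real0. Qed.

Lemma modulusM z w : modulus (z * w) = modulus z * modulus w.
Proof.
by apply: scalar_of_real_inj; rewrite scalar_of_realM !modulusE normrM.
Qed.

Lemma modulusN z : modulus (- z) = modulus z.
Proof. by apply: scalar_of_real_inj; rewrite !modulusE normrN. Qed.

Lemma modulus_eq0 z : (modulus z == 0) = (z == 0).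
Proof.
by rewrite -(inj_eq scalar_of_real_inj) scalar_of_real0 modulusE normr_eq0.
Qed.

Lemma modulus0 : modulus (0 : scalar R K) = 0.
Proof. by apply/eqP; rewrite modulus_eq0. Qed.

Lemma ler_modulusD z w : modulus (z + w) <= modulus z + modulus w.
Proof.
by rewrite -ler_scalar_of_real scalar_of_realD !modulusE ler_normD.
Qed.

Lemma ler_modulus_sum (I : Type) (r : seq I) (P : pred I)
    (F : I -> scalar R K) :
  modulus (\sum_(i <- r | P i) F i) <= \sum_(i <- r | P i) modulus (F i).
Proof.
elim/big_rec2: _ => [|i x y _ h]; first by rewrite modulus0.
exact: le_trans (ler_modulusD _ _) (lerD _ _).
Qed.

Lemma conjugate_eq0 z : (conjugate z == 0) = (z == 0).
Proof. by case: K z => z //=; rewrite conjC_eq0. Qed.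

Lemma open_lt_modulus (a : R) : open [set z : scalar R K | a < modulus z].
Proof.
rewrite openE => z /=; rewrite lt_modulus -subr_gt0 => az.
(* With this radius, the reverse triangle inequality keeps the norm above [a] on the whole ball. *)
apply/nbhs_ballP; exists (`|z| - scalar_of_real K a) => //= w.
rewrite -ball_normE /= lt_modulus => zw.
have := le_lt_trans (lerB_dist z w) zw.
by rewrite ltrD2l ltrN2.
Qed.

End Modulus.

Section Kernel.
Variables (R : realType) (K : scalar_kind) (k : nat).
Implicit Types v x : 'rV[scalar R K]_k.

Lemma continuous_inner v : continuous (inner v : _ -> scalar R K).
Proof.
move=> x; have Fx : Filter (nbhs x) := nbhs_filter x.
apply: (@cvg_big _ _ _ _ _ _ _ (nbhs x)) => [|i _]; first exact: add_continuous.
by apply: (@cvgMl_tmp _ _ (nbhs x)); exact: coord_continuous.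
Qed.

(** The rays []a, +oo[] generate the Borel sets of [R], and by continuity their preimages are
    open. *)
Lemma measurable_modulus_inner v :
  measurable_fun setT (fun x : borel_space R K k => modulus (inner v x)).
Proof.
move=> mD; apply: (measurability _ (RGenOInfty.measurableE R)) => //.
move=> /= _ [_ [a ->] <-]; rewrite setTI; apply: sub_sigma_algebra.
have -> : (fun x : borel_space R K k => modulus (inner v x)) @^-1` `]a, +oo[ =
   inner v @^-1` [set z : scalar R K | a < modulus z].
  by apply/seteqP; split=> x /=; rewrite in_itv /= andbT.
apply: open_comp; last exact: open_lt_modulus.
by move=> x _; exact: continuous_inner.
Qed.

(** The mass is built as a scaled finite sum of Dirac measures, so that integrating a nonnegative
    function reduces to evaluating it at the points. *)
Lemma uniform_probability (n : nat) (X : n.-tuple 'rV[scalar R K]_k) :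
  (0 < n)%N ->
  exists mu : probability (borel_space R K k) R,
    (forall B : set (borel_space R K k), measurable B ->
      mu B = ((n%:R^-1)%:E * \sum_(x <- X) \d_(x : borel_space R K k) B)%E) /\
    (forall f : borel_space R K k -> R,
      measurable_fun setT f -> (forall x, 0 <= f x) ->
      'E_mu[f]%E = (n%:R^-1 * \sum_(x <- X) f x)%:E).
Proof.
move=> n_gt0; pose T := borel_space R K k.
have c_ge0 : 0 <= n%:R^-1 :> R by rewrite invr_ge0.
pose ms (i : nat) : {measure set T -> \bar R} := \d_(nth 0 X i : T).
pose m : {measure set T -> \bar R} := mscale (NngNum c_ge0) (msum ms n).
have mE B : measurable B ->
    m B = ((n%:R^-1)%:E * \sum_(x <- X) \d_(x : T) B)%E.
  move=> mB; rewrite /m /= /mscale /= /msum; congr (_ * _)%E.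
  by rewrite (big_nth 0) size_tuple big_mkord.
have m1 : m setT = 1%E.
  rewrite mE//; under eq_bigr do rewrite diracT.
  rewrite sumEFin big_tnth sumr_const card_ord size_tuple -EFinM mulVf//.
  by rewrite pnatr_eq0 -lt0n.
pose mP := @Measure_isProbability.Build _ _ R m m1.
pose mu : probability T R := HB.pack (mscale (NngNum c_ge0) (msum ms n)) mP.
exists mu; split=> [B mB|f mf f0]; first exact: mE.
have f0E x : setT x -> (0 <= (f x)%:E)%E by move=> _; rewrite lee_fin.
have mfE : measurable_fun setT (EFin \o f) by exact/measurable_EFinP.
rewrite unlock (ge0_integral_mscale _ measurableT)//.
rewrite ge0_integral_measure_sum// EFinM; congr (_ * _)%E.
rewrite (big_nth 0) size_tuple big_mkord -sumEFin.
apply: eq_bigr => i _.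
by rewrite integral_dirac// diracT mul1e.
Qed.

(** A finite set is closed, so the complement of the entries of [X] is an open set of mass 0 and
    contains no support point. *)
Lemma supp_uniform (n : nat) (X : n.-tuple 'rV[scalar R K]_k)
    (mu : probability (borel_space R K k) R) :
  (forall B : set (borel_space R K k), measurable B ->
    mu B = ((n%:R^-1)%:E * \sum_(x <- X) \d_(x : borel_space R K k) B)%E) ->
  forall y, supp mu y -> y \in X.
Proof.
move=> muE y /(_ (~` [set` X])) muX; apply: contrapT => yX.
have oX : open (~` [set` X]).
  apply: closed_openC; apply: accessible_finite_set_closed.1.
    apply: hausdorff_accessible; exact: norm_hausdorff.
  exact: finite_seq.
have := muX oX yX; rewrite muE; last exact: sub_sigma_algebra.
rewrite big1_seq ?mule0 ?ltxx// => x /andP[_ xX].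
by rewrite diracE memNset//= => -[].
Qed.

End Kernel.

(** By rank-nullity the kernel has dimension [k]. Since [kermx] is the left kernel, a basis is taken
    for [A^T] and transposed. *)
Lemma kernel_basis (F : fieldType) (d k : nat) (A : 'M[F]_(d + k)) :
  \rank A = d -> exists2 B : 'M[F]_(d + k, k), row_full B & A *m B = 0.
Proof.
move=> rA; pose N := kermx A^T.
have rN : \rank N = k by rewrite mxrank_ker mxrank_tr rA addKn.
have [C rC CA] : exists2 C : 'M[F]_(\rank N, d + k),
    \rank C = \rank N & C *m A^T = 0.
  exists (row_base N); first by rewrite eq_row_base.
  by apply/sub_kermxP; rewrite eq_row_base.
rewrite rN in C rC CA; exists C^T; first by rewrite /row_full mxrank_tr rC.
by rewrite -[A]trmxK -trmx_mul CA trmx0.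
Qed.

Section OffDiagonal.
Variables (R : realType) (K : scalar_kind) (n : nat) (A : 'M[scalar R K]_n).
Hypothesis A1 : forall i, A i i = 1.

Lemma modulus_le_off i j : i != j -> modulus (A i j) <= off A.
Proof.
move=> ij.
exact: (@le_bigmax_cond _ _ _ 0 (i, j) (fun p => p.1 != p.2)
  (fun p => modulus (A p.1 p.2))).
Qed.

Lemma off_ge0 : 0 <= off A.
Proof. exact: bigmax_ge_id. Qed.

Lemma kernel_modulus_le (u : 'cV[scalar R K]_n) : A *m u = 0 ->
  forall i, (1 + off A) * modulus (u i 0) <= off A * \sum_j modulus (u j 0).
Proof.
(* Splitting off [j = i] on the right and cancelling [off A * modulus (u i 0)] leaves the triangle
   inequality for row [i]. *)
move=> Au i; rewrite [X in _ <= _ * X](bigD1 i)//= mulrDl mulrDr mul1r addrC lerD2l.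
have /eqP : (A *m u) i 0 = 0 by rewrite Au mxE.
rewrite mxE (bigD1 i)//= A1 mul1r addr_eq0 => /eqP ->.
rewrite modulusN (le_trans (ler_modulus_sum _ _ _))// mulr_sumr.
apply: ler_sum => j ji; rewrite modulusM ler_wpM2r ?modulus_ge0//.
by rewrite modulus_le_off// eq_sym.
Qed.

(** If [off A] were 0, the kernel inequality would force every entry of [u] to vanish. *)
Lemma off_gt0 (u : 'cV[scalar R K]_n) : A *m u = 0 -> u != 0 -> 0 < off A.
Proof.
move=> Au u0; rewrite lt_neqAle off_ge0 andbT; apply: contra u0 => /eqP o0.
apply/eqP/colP => i; apply/eqP; rewrite mxE -modulus_eq0 eq_le modulus_ge0 andbT.
by have := kernel_modulus_le Au i; rewrite -o0 addr0 mul1r mul0r.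
Qed.

End OffDiagonal.

Lemma one_div_ereal_le (R : realType) (l : \bar R) (n o : R) :
  0 < n -> 0 < o -> (((1 + o) / (n * o))%:E <= l)%E ->
  (1 / (l * n%:E - 1) <= o%:E)%E.
Proof.
move=> n0 o0; case: l => [l||//]; last first.
  (* For [l = +oo] the left-hand side is [1 / +oo = 0]. *)
  by move=> _; rewrite gt0_mulye ?lte_fin// addye// invey mule0 lee_fin ltW.
rewrite lee_fin ler_pdivrMr ?mulr_gt0// => le_l.
have ln_ge : 1 <= (l * n - 1) * o by nra.
have ln_gt0 : 0 < l * n - 1 by rewrite -(pmulr_lgt0 _ o0) (lt_le_trans _ ln_ge).
rewrite -EFinM -EFinB inver gt_eqF// -EFinM lee_fin mul1r.
by rewrite -[_^-1]mul1r ler_pdivrMr// mulrC.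
Qed.

Lemma uniform_mass_Lmu_ge (R : realType) (K : scalar_kind) (d k : nat)
    (A : 'M[scalar R K]_(d + k)) :
  (0 < k)%N -> \rank A = d -> (forall i, A i i = 1) ->
  0 < off A /\ exists2 mu, @uniform_masses R K d k mu &
    (((1 + off A) / ((d + k)%:R * off A))%:E <= Lmu mu)%E.
Proof.
move=> k0 rA A1; have [B /row_fullP[C CB] AB] := kernel_basis rA.
have n0 : (0 < d + k)%N by rewrite addn_gt0 k0 orbT.
(* [B] is injective because [C] is a left inverse. *)
have Bw_neq0 w : w != 0 -> B *m w != 0 :> 'cV_(d + k).
  by apply: contra => /eqP Bw; rewrite -[w]mul1mx -CB -mulmxA Bw mulmx0.
have ABw (w : 'cV_k) : A *m (B *m w) = 0 by rewrite mulmxA AB mul0mx.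
have o0 : 0 < off A.
  (* As [0 < k], the all-ones vector is nonzero, and [B] sends it to a nonzero kernel vector. *)
  apply: (@off_gt0 _ _ _ _ A1 (B *m const_mx 1)); first exact: ABw.
  apply: Bw_neq0; apply/eqP => /colP/(_ (Ordinal k0)).
  by rewrite !mxE => /eqP; rewrite oner_eq0.
split=> //.
pose X := [tuple row i B | i < d + k].
have [mu [muE EmuE]] := uniform_probability X n0.
exists mu.
  (* The rows of [B] span, since [v = (v *m C) *m B]. *)
  exists X => //; apply/eqP; rewrite eqEsubv subvf /=; apply/subvP => v _.
  rewrite -[v]mulmx1 -CB mulmxA mulmx_sum_row memv_suml// => i _.
  by rewrite memvZ// memv_span//; apply/mapP; exists i; rewrite ?mem_enum.
apply: le_ereal_inf_tmp => _ [y [/(supp_uniform muE)/mapP[i _ ->] _] <-].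
apply: le_ereal_inf_tmp => _ [v /= v0 <-].
(* [inner] conjugates its first argument, so the entries of [B *m w] are exactly the
   [inner v x_j]. *)
pose w : 'cV[scalar R K]_k := \col_j conjugate (v 0 j).
have w0 : w != 0.
  apply: contra v0 => /eqP/colP w0; apply/eqP/rowP => j; apply/eqP.
  by rewrite mxE -conjugate_eq0; have := w0 j; rewrite !mxE => ->.
have innerE j : inner v (row j B) = (B *m w) j 0.
  by rewrite mxE; apply: eq_bigr => l _; rewrite !mxE mulrC.
rewrite EmuE; last 2 first.
- exact: measurable_modulus_inner.
- by move=> x; exact: modulus_ge0.
rewrite big_map big_enum /=; under eq_bigr do rewrite innerE.
rewrite innerE.
have := kernel_modulus_le A1 (ABw w) i.
set S := \sum_j _; set a := modulus _ => aS.
(* If [S] were 0, then [B *m w = 0], against injectivity. Positivity of the numerator is what makes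
   the quotient [+oo] when [a = 0]. *)
have S0 : 0 < S.
  rewrite lt_neqAle sumr_ge0 ?andbT; last by move=> *; exact: modulus_ge0.
  apply: contra (Bw_neq0 _ w0) => /eqP S0; apply/eqP/colP => j; apply/eqP.
  rewrite [X in _ == X]mxE -modulus_eq0.
  have /psumr_eq0P := esym S0.
  by move=> -> // *; exact: modulus_ge0.
have nR0 : 0 < (d + k)%:R :> R by rewrite ltr0n.
(* The quotient is [+oo] when [<v, x_i> = 0]. *)
have [a0|a0] := eqVneq a 0.
  by rewrite a0 inver eqxx gt0_muley ?leey// lte_fin mulr_gt0// invr_gt0.
have {}a0 : 0 < a by rewrite lt_def a0 modulus_ge0.
(* Clearing denominators turns the goal into the kernel inequality [aS]. *)
rewrite inver gt_eqF// -EFinM lee_fin ler_pdivlMr// mulrAC ler_pdivrMr ?mulr_gt0//.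
by rewrite mulrACA mulVf ?gt_eqF// mul1r [S * _]mulrC.
Qed.

Theorem theorem2p4 (R : realType) (K : scalar_kind) (d k : nat)
    (hd : (0 < d)%N) (hk : (0 < k)%N) :
  (1 / (Lsup R K d k * (d + k)%:R%:E - 1) <= offmin R K d k)%E.
Proof.
apply: le_ereal_inf_tmp => _ [A [rA A1] <-].
have [off0 [mu mu_unif le_mu]] := uniform_mass_Lmu_ge hk rA A1.
apply: one_div_ereal_le => //; first by rewrite ltr0n addn_gt0 hd.
by apply: le_trans le_mu _; apply: ereal_sup_ubound; exists mu.
Qed.
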